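(* Let $A$ be a Banach algebra, let $I$ be a closed two-sided ideal in $A$, and suppose that $A$ is $I$-weakly amenable. Let $\varphi$ be a character on $A$ such that $I\not\subseteq \ker\varphi$. Then there is no non-zero point derivation on $A$ at $\varphi$.
   Context: For a Banach $A$-bimodule $X$ (a Banach space that is an $A$-bimodule with jointly continuous module operations), the dual $X^*$ is a Banach $A$-bimodule via $\langle x,a\cdot x^*\rangle=\langle x\cdot a,x^*\rangle$ and $\langle x,x^*\cdot a\rangle=\langle a\cdot x,x^*\rangle$. A derivation $D:A\to X$ is a continuous linear map with $D(ab)=a\cdot D(b)+D(a)\cdot b$ for all $a,b\in A$; it is inner if there is $x\in X$ with $D(a)=a\cdot x-x\cdot a$ for all $a\in A$. $H^1(A,X)=\{0\}$ means every derivation $A\to X$ is inner. For a closed two-sided ideal $I$ of $A$ (a Banach $A$-bimodule under multiplication), $A$ is $I$-weakly amenable if $H^1(A,I^* )=\{0\}$. A character is a non-zero multiplicative linear functional $\varphi:A\to\mathbb{C}$. A point derivation at $\varphi$ is a continuous linear functional $d$ on $A$ with $d(ab)=\varphi(a)d(b)+d(a)\varphi(b)$ for all $a,b\in A$, i.e. a derivation from $A$ into the bimodule $\mathbb{C}$ with actions $a\cdot z=z\cdot a=\varphi(a)z$. *)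

(* Defs.v *)
From HB Require Import structures.
From mathcomp Require Import all_boot all_order all_algebra.
From mathcomp Require Import complex.
From mathcomp Require Import boolp classical_sets functions reals.
From mathcomp Require Import topology normedtype.

Set Implicit Arguments.
Unset Strict Implicit.
Unset Printing Implicit Defensive.
Import Order.TTheory GRing.Theory Num.Theory.
Import numFieldNormedType.Exports.
Local Open Scope classical_set_scope.
Local Open Scope ring_scope.
Local Open Scope complex_scope.

Section complex_complete.
Variable R : realType.

Lemma normc_real (x : R) : `|x%:C| = `|x|%:C.
Proof. by rewrite normc_def/= expr0n/= addr0 sqrtr_sqr. Qed.

Lemma normci : `|'i%C : R[i]| = 1.
Proof. by rewrite normc_def/= expr0n/= add0r expr1n sqrtr1. Qed.

Lemma complex_complete (F : set_system R[i]^o) :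
  ProperFilter F -> cauchy F -> cvg F.
Proof.
move=> FF Fc.
have part (p : R[i]^o -> R^o) : (forall x y, p (x - y) = p x - p y) ->
    (forall x, `|p x|%:C <= `|x|) -> cvg (p @ F).
  move=> pB ple; apply: R_complete; apply/cauchy_ballP => e e0.
  have e0C : 0 < e%:C :> R[i] by rewrite ltcR.
  have /cauchy_ballP/(_ _ e0C) := Fc.
  move=> h; rewrite near_map2.
  apply: filterS h => -[x y] /=.
  rewrite -!ball_normE/= -pB -ltcR.
  exact: le_lt_trans (ple _).
have cRe : cvg ((@complex.Re R : R[i]^o -> R^o) @ F).
  apply: part => [[a b] [c d]//|x]; exact: normc_ge_Re.
have cIm : cvg ((@complex.Im R : R[i]^o -> R^o) @ F).
  apply: part => [[a b] [c d]//|x].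
  rewrite -normrN -ReiNIm.
  by apply: le_trans (normc_ge_Re _) _; rewrite normrM normci mulr1.
set a := lim ((@complex.Re R : R[i]^o -> R^o) @ F) in cRe *.
set b := lim ((@complex.Im R : R[i]^o -> R^o) @ F) in cIm *.
apply/cvg_ex; exists ((a +i* b) : R[i]^o).
apply/cvgrPdist_le => e e0.
have eE : (complex.Re e)%:C = e by rewrite RRe_real// gtr0_real.
have r0 : 0 < complex.Re e / 2 by rewrite divr_gt0// -ltcR eE.
have /cvgrPdist_le/(_ _ r0) ha := cRe.
have /cvgrPdist_le/(_ _ r0) hb := cIm.
near=> z.
have -> : (a +i* b : R[i]) - z =
    (a - complex.Re z)%:C + 'i%C * (b - complex.Im z)%:C.
  by rewrite [LHS]complexE; case: (z).
apply: le_trans (ler_normD _ _) _.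
rewrite normrM normci mul1r !normc_real -rmorphD/= -[leRHS]eE lecR.
by rewrite [leRHS]splitr lerD//; near: z.
Unshelve. all: by end_near. Qed.

End complex_complete.

Section bilinear_continuity.
Variables (K : numFieldType) (U V W : normedModType K) (b : U -> V -> W).
Hypothesis bl : forall v, linear (b^~ v).
Hypothesis br : forall u, linear (b u).

Let b0l v : b 0 v = 0.
Proof. by have := bl v (-1) 0 0; rewrite scaler0 addr0 scaleN1r addNr. Qed.

Let b0r u : b u 0 = 0.
Proof. by have := br u (-1) 0 0; rewrite scaler0 addr0 scaleN1r addNr. Qed.

Let bZl k u v : b (k *: u) v = k *: b u v.
Proof. by have := bl v k u 0; rewrite !addr0 b0l addr0. Qed.

Let bZr k u v : b u (k *: v) = k *: b u v.
Proof. by have := br u k v 0; rewrite !addr0 b0r addr0. Qed.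

Let bBl u u' v : b (u - u') v = b u v - b u' v.
Proof. by have /= := bl v (-1) u' u; rewrite !scaleN1r ![- _ + _]addrC. Qed.

Let bBr u v v' : b u (v - v') = b u v - b u v'.
Proof. by have := br u (-1) v' v; rewrite !scaleN1r ![- _ + _]addrC. Qed.

Lemma bilinear_bounded : continuous (fun p : U * V => b p.1 p.2) ->
  exists2 M : K, 0 <= M & forall u v, `|b u v| <= M * `|u| * `|v|.
Proof.
move=> /(_ (0, 0)) /cvgr_norm_le/=; rewrite b0l normr0 => /(_ _ ltr01).
move=> /nbhs_ballP[d /= d0 h].
have d20 : 0 < d / 2 by rewrite divr_gt0.
exists ((d / 2) ^- 2); first by rewrite invr_ge0 exprn_ge0// ltW.
move=> u v; have [->|u0] := eqVneq u 0; first by rewrite b0l !normr0 mulr0 mul0r.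
have [->|v0] := eqVneq v 0; first by rewrite b0r !normr0 mulr0.
have nu : 0 < `|u| by rewrite normr_gt0.
have nv : 0 < `|v| by rewrite normr_gt0.
have small (T : normedModType K) (t : T) : t != 0 -> ball 0 d (d / 2 / `|t| *: t).
  move=> t0; rewrite -ball_normE/= sub0r normrN normrZ ger0_norm; last first.
    by rewrite divr_ge0// ltW.
  by rewrite divfK ?normr_eq0// ltr_pdivrMr// ltr_pMr// ltr1n.
have /= := h (d / 2 / `|u| *: u, d / 2 / `|v| *: v) (conj (small _ _ u0) (small _ _ v0)).
rewrite bZl bZr scalerA normrZ ger0_norm; last by rewrite mulr_ge0// divr_ge0// ltW.
rewrite mulrACA -expr2 -invfM -ler_pdivlMl; last by apply: divr_gt0; [exact: exprn_gt0 | exact: mulr_gt0].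
by rewrite mulr1 invf_div mulrC mulrA.
Qed.

Lemma bounded_bilinear (M : K) : 0 <= M ->
  (forall u v, `|b u v| <= M * `|u| * `|v|) ->
  continuous (fun p : U * V => b p.1 p.2).
Proof.
move=> M0 bM [u0 v0]; apply/cvgrPdist_le => /= e e0.
pose c := M * (`|v0| + 1 + `|u0|) + 1.
have c0 : 0 < c by rewrite ltr_wpDl// mulr_ge0// !addr_ge0.
have cu : \forall p \near (u0, v0), `|u0 - p.1| <= e / c.
  by apply: (cvgr_dist_le _ _ cvg_fst); rewrite divr_gt0.
have cv : \forall p \near (u0, v0), `|v0 - p.2| <= e / c.
  by apply: (cvgr_dist_le _ _ cvg_snd); rewrite divr_gt0.
have cv1 : \forall p \near (u0, v0), `|v0 - p.2| <= 1.
  by apply: (cvgr_dist_le _ _ cvg_snd).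
near=> p.
have -> : b u0 v0 - b p.1 p.2 = b (u0 - p.1) p.2 + b u0 (v0 - p.2).
  by rewrite bBl bBr [RHS]addrC addrA subrK.
apply: le_trans (ler_normD _ _) _.
have p2 : `|p.2| <= `|v0| + 1.
  rewrite -[p.2](subKr v0); apply: le_trans (ler_normB _ _) _.
  by rewrite lerD2l; near: p.
have -> : e = c * (e / c) by rewrite mulrC divfK// gt_eqF.
apply: (@le_trans _ _ (M * (`|v0| + 1 + `|u0|) * (e / c))); last first.
  by rewrite ler_wpM2r ?divr_ge0 ?ltW// ltrDl.
rewrite -mulrA mulrDl mulrDr lerD//.
  apply: le_trans (bM _ _) _; rewrite -mulrA ler_wpM2l// mulrC ler_pM//.
  by near: p.
apply: le_trans (bM _ _) _; rewrite -mulrA ler_wpM2l// ler_wpM2l//.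
by near: p.
Unshelve. all: by end_near. Qed.

End bilinear_continuity.

(* Associative, not necessarily unital. *)
HB.mixin Record CompleteNormedModule_isBanachAlgebra (K : numFieldType) A
    & CompleteNormedModule K A := {
  amul : A -> A -> A;
  amulA : associative amul;
  amul_linearl : forall b, linear (amul^~ b);
  amul_linearr : forall a, linear (amul a);
  ler_norm_amul : forall a b, `|amul a b| <= `|a| * `|b|
}.

#[short(type="banachAlgType")]
HB.structure Definition BanachAlgebra (K : numFieldType) :=
  {A of CompleteNormedModule K A & CompleteNormedModule_isBanachAlgebra K A}.

Notation "a ⋆ b" := (amul a b) (at level 40, left associativity) : ring_scope.

Record banachBimodule (K : numFieldType) (A : banachAlgType K) := BanachBimodule {
  bimod_sort :> completeNormedModType K;
  lact : A -> bimod_sort -> bimod_sort;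
  ract : bimod_sort -> A -> bimod_sort;
  lact_linearl : forall x, linear (lact^~ x);
  lact_linearr : forall a, linear (lact a);
  ract_linearl : forall a, linear (ract^~ a);
  ract_linearr : forall x, linear (ract x);
  lactA : forall a b x, lact (a ⋆ b) x = lact a (lact b x);
  ractA : forall x a b, ract x (a ⋆ b) = ract (ract x a) b;
  lract : forall a x b, lact a (ract x b) = ract (lact a x) b;
  lact_continuous : continuous (fun p : A * bimod_sort => lact p.1 p.2);
  ract_continuous : continuous (fun p : bimod_sort * A => ract p.1 p.2)
}.

Arguments lact {K A _} a x.
Arguments ract {K A _} x a.
Notation "a ·> x" := (lact a x) (at level 40, left associativity) : ring_scope.
Notation "x <· a" := (ract x a) (at level 40, left associativity) : ring_scope.

Section derivations.
Variables (K : numFieldType) (A : banachAlgType K) (X : banachBimodule A).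

Definition derivation (D : A -> X) :=
  [/\ linear D, continuous D & forall a b, D (a ⋆ b) = a ·> D b + D a <· b].

Definition inner (D : A -> X) :=
  exists x : X, forall a, D a = a ·> x - x <· a.

(* H^1(A, X) = 0 *)
Definition trivial_H1 := forall D : A -> X, derivation D -> inner D.

End derivations.
Arguments trivial_H1 {K A} X.

Section dual.
Variables (R : realType) (V : normedModType R[i]).

(* The scalars are written R[i]^o because the canonical normed and topological
   structures are attached to the regular module, not to R[i] itself. *)
Record dual := Dual {
  dual_val :> V -> R[i]^o;
  _ : `[< linear dual_val /\ continuous dual_val >]
}.

HB.instance Definition _ := [isSub for dual_val].
HB.instance Definition _ := [Choice of dual by <:].

Let dual_closed :
  submod_closed (fun f : V -> R[i]^o => `[< linear f /\ continuous f >]).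
Proof.
split.
  apply/asboolP; split; last by move=> x; exact: cvg_cst.
  by move=> k x y; rewrite -[RHS]/(k *: 0 + 0) scaler0 addr0.
move=> k f g /asboolP[fl fc] /asboolP[gl gc]; apply/asboolP; split.
  move=> l x y.
  rewrite -[LHS]/(k *: f (l *: x + y) + g (l *: x + y)).
  rewrite -[RHS]/(l *: (k *: f x + g x) + (k *: f y + g y)).
  by rewrite fl gl !scalerDr addrACA !scalerA [l * k]mulrC.
by move=> x; apply: cvgD; [apply: cvgZr; exact: fc | exact: gc].
Qed.

HB.instance Definition _ :=
  GRing.SubChoice_isSubLmodule.Build R[i] (V -> R[i]^o) _ dual dual_closed.

Lemma dual_linear (f : dual) : linear f.
Proof. by have /asboolP[] := valP f. Qed.

HB.instance Definition _ (f : dual) :=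
  GRing.isLinear.Build R[i] V R[i]^o *:%R (dual_val f) (dual_linear f).

Lemma dual_continuous (f : dual) : continuous f.
Proof. by have /asboolP[] := valP f. Qed.

(* The operator norm; R[i]-valued as normedModType R[i] requires. *)
Definition dual_norm (f : dual) : R[i] :=
  (sup [set complex.Re `|f x| | x in [set x | `|x| <= 1]])%:C.

Lemma dual_bounded (f : dual) :
  exists2 M : R[i], 0 <= M & forall x, `|f x| <= M * `|x|.
Proof.
have /linear_bounded_continuous/linear_boundedP := @dual_continuous f.
by move=> /pinfty_ex_gt0[M M0 h]; exists M => //; exact: ltW.
Qed.

Let ReK (f : dual) x : (complex.Re `|f x|)%:C = `|f x|.
Proof. by rewrite RRe_real// normr_real. Qed.

Let dual_norm_ubound (f : dual) x : `|x| <= 1 -> `|f x| <= dual_norm f.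
Proof.
move=> x1; rewrite -ReK lecR; apply: ub_le_sup; last by exists x.
have [M M0 fM] := dual_bounded f; exists (complex.Re M) => _ /= [y y1 <-].
rewrite -lecR ReK RRe_real ?ger0_real//; apply: le_trans (fM _) _.
by rewrite -[leRHS]mulr1 ler_wpM2l.
Qed.

Lemma dual_norm_ub (f : dual) x : `|f x| <= dual_norm f * `|x|.
Proof.
have [->|x0] := eqVneq x 0; first by rewrite linear0 !normr0 mulr0.
have nx : 0 < `|x| by rewrite normr_gt0.
rewrite -ler_pdivrMr// mulrC -[`|x|^-1]ger0_norm ?invr_ge0// -normrZ -linearZ/=.
apply: dual_norm_ubound.
by rewrite normrZ ger0_norm ?invr_ge0// mulVf// gt_eqF.
Qed.

Lemma dual_norm_ge0 (f : dual) : 0 <= dual_norm f.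
Proof. by apply: le_trans (@dual_norm_ubound f 0 _); rewrite ?normr0. Qed.

Lemma dual_norm_le (f : dual) M : 0 <= M ->
  (forall x, `|f x| <= M * `|x|) -> dual_norm f <= M.
Proof.
move=> M0 fM.
rewrite -[leRHS]RRe_real ?ger0_real// lecR; apply: ge_sup.
  by exists (complex.Re `|f 0|), 0 => //=; rewrite normr0.
move=> _ /= [y y1 <-]; rewrite -lecR ReK RRe_real ?ger0_real//.
by apply: le_trans (fM _) _; rewrite -[leRHS]mulr1 ler_wpM2l.
Qed.

Let dual_normD f g : dual_norm (f + g) <= dual_norm f + dual_norm g.
Proof.
apply: dual_norm_le => [|x]; first by rewrite addr_ge0// dual_norm_ge0.
by rewrite (le_trans (ler_normD _ _))// mulrDl lerD// dual_norm_ub.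
Qed.

Let dual_normZ_le k f : dual_norm (k *: f) <= `|k| * dual_norm f.
Proof.
apply: dual_norm_le => [|x]; first by rewrite mulr_ge0// dual_norm_ge0.
by rewrite /= normrZ -mulrA ler_wpM2l// dual_norm_ub.
Qed.

Let dual_normZ k f : dual_norm (k *: f) = `|k| * dual_norm f.
Proof.
apply/eqP; rewrite eq_le dual_normZ_le/=.
have [->|k0] := eqVneq k 0; first by rewrite normr0 mul0r dual_norm_ge0.
rewrite -ler_pdivlMl ?normr_gt0// -normfV -[f in leLHS](scalerK k0).
exact: dual_normZ_le.
Qed.

Let dual_norm0_eq0 f : dual_norm f = 0 -> f = 0.
Proof.
move=> f0; apply/val_inj/funext => x /=; apply/normr0_eq0/le_anti.
by rewrite normr_ge0 andbT (le_trans (dual_norm_ub _ _))// f0 mul0r.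
Qed.

HB.instance Definition _ :=
  Lmodule_isNormed.Build R[i] dual dual_normD dual_normZ dual_norm0_eq0.

Let dual_complete (F : set_system dual) : ProperFilter F -> cauchy F -> cvg F.
Proof.
move=> FF /cauchy_ballP Fc.
have small (f g : dual) e x : ball f e g -> `|f x - g x| <= e * `|x|.
  rewrite -ball_normE/= => /ltW fg.
  by rewrite (le_trans (dual_norm_ub (f - g) x))// ler_wpM2r.
have Fcx x : cvg ((fun f : dual => f x) @ F).
  apply: complex_complete; apply/cauchy_ballP => e e0.
  have e'0 : 0 < e / (`|x| + 1) by rewrite divr_gt0// ltr_wpDl.
  rewrite near_map2; apply: filterS (Fc _ e'0) => -[f g] /= fg.
  rewrite -ball_normE/=; apply: le_lt_trans (small _ _ _ x fg) _.
  by rewrite mulrAC ltr_pdivrMr ?ltr_wpDl// ltr_pM2l// ltrDl.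
pose g x : R[i]^o := lim ((fun f : dual => f x) @ F).
have gl : linear g.
  move=> k x y; apply: (@cvg_lim R[i]^o) => //.
  rewrite (_ : (fun f : dual => f _) = (fun f => k *: f x + f y)); last first.
    by apply/funext => f; rewrite linearP.
  by apply: cvgD; [apply: cvgZr; exact: Fcx | exact: Fcx].
have g0 : g 0 = 0 by rewrite -(scaler0 _ (-1)) -[-1 *: 0]addr0 gl scaleN1r addNr.
have gP e : 0 < e ->
    \forall f \near F, forall x, `|dual_val f x - g x| <= e * `|x|.
  move=> e0; have e20 : 0 < e / 2 by rewrite divr_gt0.
  apply: filterS (nearP_dep (Fc _ e20)) => f /= Ff x.
  have [->|x0] := eqVneq x 0; first by rewrite linear0 g0 subrr !normr0 mulr0.
  have ex0 : 0 < e / 2 * `|x| by rewrite mulr_gt0// normr_gt0.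
  have Fx : \forall h \near F, `|g x - dual_val h x| <= e / 2 * `|x|.
    by have /cvgrPdist_le := Fcx x; apply.
  have [h [fh hg]] := filter_ex (filterI Ff Fx).
  rewrite -(subrK (h x) (f x)) -addrA (le_trans (ler_normD _ _))//.
  by rewrite [e]splitr mulrDl lerD// ?small// distrC.
have gc : continuous g.
  have [f Ff] := filter_ex (gP 1 ltr01).
  have [M M0 fM] := dual_bounded f.
  pose g' : {linear V -> R[i]^o} :=
    HB.pack g (GRing.isLinear.Build R[i] V R[i]^o *:%R g gl).
  apply: (bounded_linear_continuous (f := g')); apply/bounded_funP => r.
  exists ((M + 1) * r) => x xr; rewrite -[g' x](subKr (f x)).
  rewrite (le_trans (ler_normB _ _))// mulrDl lerD//.
    by rewrite (le_trans (fM x))// ler_wpM2l.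
  by rewrite (le_trans (Ff x))// !mul1r.
have gd : `[< linear g /\ continuous g >] by apply/asboolP.
apply/cvg_ex; exists (Dual gd); apply/cvgrPdist_le => e e0.
apply: filterS (gP _ e0) => f fg; rewrite distrC.
by apply: dual_norm_le; [exact: ltW | exact: fg].
Qed.

HB.instance Definition _ := Uniform_isComplete.Build dual dual_complete.

End dual.

Section dual_bimodule.
Variables (R : realType) (A : banachAlgType R[i]) (X : banachBimodule A).

Let pair_continuous (f : dual X) (a : A) :
  `[< linear (fun x => f (x <· a)) /\ continuous (fun x => f (x <· a)) >] /\
  `[< linear (fun x => f (a ·> x)) /\ continuous (fun x => f (a ·> x)) >].
Proof.
have cr : continuous (fun x : X => x <· a).
  move=> x; apply: (@continuous_comp _ _ _ (fun x => (x, a)) (fun p => p.1 <· p.2)).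
    by apply: cvg_pair; [exact: cvg_id | exact: cvg_cst].
  exact: ract_continuous.
have cl : continuous (fun x : X => a ·> x).
  move=> x; apply: (@continuous_comp _ _ _ (fun x => (a, x)) (fun p => p.1 ·> p.2)).
    by apply: cvg_pair; [exact: cvg_cst | exact: cvg_id].
  exact: lact_continuous.
split; apply/asboolP; split.
- by move=> k x y; rewrite ract_linearl linearP.
- by move=> x; exact: (continuous_comp (cr x) (@dual_continuous _ _ f _)).
- by move=> k x y; rewrite lact_linearr linearP.
- by move=> x; exact: (continuous_comp (cl x) (@dual_continuous _ _ f _)).
Qed.

(* <x, a · f> = <x · a, f> and <x, f · a> = <a · x, f> *)
Definition dual_lact (a : A) (f : dual X) : dual X :=
  Dual (pair_continuous f a).1.
Definition dual_ract (f : dual X) (a : A) : dual X :=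
  Dual (pair_continuous f a).2.

Let lactl f : linear (dual_lact^~ f).
Proof.
by move=> k a b; apply/val_inj/funext => x /=; rewrite ract_linearr linearP.
Qed.

Let lactr a : linear (dual_lact a).
Proof. by move=> k f g; apply/val_inj/funext => x. Qed.

Let ractl a : linear (dual_ract^~ a).
Proof. by move=> k f g; apply/val_inj/funext => x. Qed.

Let ractr f : linear (dual_ract f).
Proof.
by move=> k a b; apply/val_inj/funext => x /=; rewrite lact_linearl linearP.
Qed.

Let lactM a b f : dual_lact (a ⋆ b) f = dual_lact a (dual_lact b f).
Proof. by apply/val_inj/funext => x /=; rewrite ractA. Qed.

Let ractM f a b : dual_ract f (a ⋆ b) = dual_ract (dual_ract f a) b.
Proof. by apply/val_inj/funext => x /=; rewrite lactA. Qed.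

Let lractM a f b : dual_lact a (dual_ract f b) = dual_ract (dual_lact a f) b.
Proof. by apply/val_inj/funext => x /=; rewrite lract. Qed.

Let lactC : continuous (fun p : A * dual X => dual_lact p.1 p.2).
Proof.
have [M M0 hM] := bilinear_bounded (@ract_linearl _ _ X) (@ract_linearr _ _ X)
  (@ract_continuous _ _ X).
apply: (bounded_bilinear lactl lactr M0) => a f.
apply: dual_norm_le => [|x]; first by rewrite !mulr_ge0.
apply: le_trans (dual_norm_ub f (x <· a)) _.
have -> : M * `|a| * `|f| * `|x| = `|f| * (M * `|x| * `|a|).
  by rewrite [RHS]mulrC -!mulrA; congr (M * _); rewrite [RHS]mulrC mulrA.
by apply: ler_wpM2l; [exact: dual_norm_ge0 | exact: hM].
Qed.

Let ractC : continuous (fun p : dual X * A => dual_ract p.1 p.2).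
Proof.
have [M M0 hM] := bilinear_bounded (@lact_linearl _ _ X) (@lact_linearr _ _ X)
  (@lact_continuous _ _ X).
apply: (bounded_bilinear ractl ractr M0) => f a.
apply: dual_norm_le => [|x]; first by rewrite !mulr_ge0.
apply: le_trans (dual_norm_ub f (a ·> x)) _.
have -> : M * `|f| * `|a| * `|x| = `|f| * (M * `|a| * `|x|).
  by rewrite -!mulrA mulrCA.
by apply: ler_wpM2l; [exact: dual_norm_ge0 | exact: hM].
Qed.

Definition dual_bimod : banachBimodule A :=
  @BanachBimodule R[i] A (dual X) dual_lact dual_ract
    lactl lactr ractl ractr lactM ractM lractM lactC ractC.

End dual_bimodule.

Record closedIdeal (K : numFieldType) (A : banachAlgType K) := ClosedIdeal {
  ideal_set :> set A;
  ideal_closed : closed ideal_set;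
  ideal0 : ideal_set 0;
  ideal_linear : forall k x y, ideal_set x -> ideal_set y ->
    ideal_set (k *: x + y);
  ideal_mull : forall a x, ideal_set x -> ideal_set (a ⋆ x);
  ideal_mulr : forall a x, ideal_set x -> ideal_set (x ⋆ a)
}.

Section ideal_bimodule.
Variables (K : numFieldType) (A : banachAlgType K) (I : closedIdeal A).

Record ideal_elt := IdealElt {
  ideal_val :> A;
  _ : ideal_val \in ideal_set I
}.

HB.instance Definition _ := [isSub for ideal_val].
HB.instance Definition _ := [Choice of ideal_elt by <:].

Let ideal_submod : submod_closed (fun x : A => x \in ideal_set I).
Proof.
split=> [|k x y /set_mem Ix /set_mem Iy]; first exact/mem_set/ideal0.
exact/mem_set/ideal_linear.
Qed.

HB.instance Definition _ :=
  GRing.SubChoice_isSubLmodule.Build K A _ ideal_elt ideal_submod.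

Let ideal_norm (x : ideal_elt) : K := `|ideal_val x|.

Let ideal_normD x y : ideal_norm (x + y) <= ideal_norm x + ideal_norm y.
Proof. exact: ler_normD. Qed.

Let ideal_normZ k x : ideal_norm (k *: x) = `|k| * ideal_norm x.
Proof. exact: normrZ. Qed.

Let ideal_norm0_eq0 x : ideal_norm x = 0 -> x = 0.
Proof. by move=> /normr0_eq0 x0; exact: val_inj. Qed.

HB.instance Definition _ :=
  Lmodule_isNormed.Build K ideal_elt ideal_normD ideal_normZ ideal_norm0_eq0.

Let ideal_complete (F : set_system ideal_elt) :
  ProperFilter F -> cauchy F -> cvg F.
Proof.
move=> FF /cauchy_ballP Fc.
have cA : cvg (ideal_val @ F).
  apply/cauchy_cvgP/cauchy_ballP => e e0; rewrite near_map2.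
  apply: filterS (Fc _ e0) => -[x y] /=.
  by rewrite -!ball_normE.
have Il : lim (ideal_val @ F) \in ideal_set I.
  apply/mem_set; apply: (closed_cvg _ (@ideal_closed _ _ I)) cA.
  by apply: nearW => x; exact/set_mem/(valP x).
apply/cvg_ex; exists (IdealElt Il); apply/cvgrPdist_le => e e0.
by have /cvgrPdist_le := cA; apply.
Qed.

HB.instance Definition _ := Uniform_isComplete.Build ideal_elt ideal_complete.

Definition ideal_lact (a : A) (x : ideal_elt) : ideal_elt :=
  IdealElt (mem_set (ideal_mull a (set_mem (valP x)))).
Definition ideal_ract (x : ideal_elt) (a : A) : ideal_elt :=
  IdealElt (mem_set (ideal_mulr a (set_mem (valP x)))).

Let lactl x : linear (ideal_lact^~ x).
Proof. by move=> k a b; apply/val_inj; exact: amul_linearl. Qed.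

Let lactr a : linear (ideal_lact a).
Proof. by move=> k x y; apply/val_inj; exact: amul_linearr. Qed.

Let ractl a : linear (ideal_ract^~ a).
Proof. by move=> k x y; apply/val_inj; exact: amul_linearl. Qed.

Let ractr x : linear (ideal_ract x).
Proof. by move=> k a b; apply/val_inj; exact: amul_linearr. Qed.

Let lactM a b x : ideal_lact (a ⋆ b) x = ideal_lact a (ideal_lact b x).
Proof. by apply/val_inj; rewrite /= amulA. Qed.

Let ractM x a b : ideal_ract x (a ⋆ b) = ideal_ract (ideal_ract x a) b.
Proof. by apply/val_inj; rewrite /= amulA. Qed.

Let lractM a x b : ideal_lact a (ideal_ract x b) = ideal_ract (ideal_lact a x) b.
Proof. by apply/val_inj; rewrite /= amulA. Qed.

Let lactC : continuous (fun p : A * ideal_elt => ideal_lact p.1 p.2).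
Proof.
apply: (bounded_bilinear lactl lactr ler01) => a x.
by rewrite mul1r; exact: ler_norm_amul.
Qed.

Let ractC : continuous (fun p : ideal_elt * A => ideal_ract p.1 p.2).
Proof.
apply: (bounded_bilinear ractl ractr ler01) => x a.
by rewrite mul1r; exact: ler_norm_amul.
Qed.

Definition ideal_bimod : banachBimodule A :=
  @BanachBimodule K A ideal_elt ideal_lact ideal_ract
    lactl lactr ractl ractr lactM ractM lractM lactC ractC.

End ideal_bimodule.

Definition ideal_weakly_amenable (R : realType) (A : banachAlgType R[i])
    (I : closedIdeal A) :=
  trivial_H1 (dual_bimod (ideal_bimod I)).

Section characters.
Variables (R : realType) (A : banachAlgType R[i]).

(* Continuity is not required: it is automatic. *)
Definition character (phi : A -> R[i]^o) :=
  [/\ linear phi, forall a b, phi (a ⋆ b) = phi a * phi b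
    & exists a, phi a != 0].

Definition point_derivation (phi d : A -> R[i]^o) :=
  [/\ linear d, continuous d
    & forall a b, d (a ⋆ b) = phi a * d b + d a * phi b].

End characters.

(* Main.v *)
(* If [d] is a non-zero point derivation at [phi], then [a |-> d a *: phi|_I] is
   a derivation into the dual of [I], so it equals [a |-> a · f - f · a] for
   some [f].  Evaluating at [x = a] in [I] gives [d x * phi x = 0] on [I].  The
   ideal contains some [x] with [phi x != 0]; hence [d] vanishes at every such
   [x].  Applying [d] to [a ⋆ x], again in [I], gives [d a = 0] whenever
   [phi a != 0]; if [phi a = 0], apply this to [x + a]. *)

Require Import Defs.
From mathcomp Require Import ring.
From HB Require Import structures.
From mathcomp Require Import all_boot all_order all_algebra.
From mathcomp Require Import complex.
From mathcomp Require Import boolp classical_sets functions reals.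
From mathcomp Require Import topology normedtype.
Import Order.TTheory GRing.Theory Num.Theory.
Import numFieldNormedType.Exports.
Local Open Scope classical_set_scope.
Local Open Scope ring_scope.
Local Open Scope complex_scope.

Set Implicit Arguments.
Unset Strict Implicit.
Unset Printing Implicit Defensive.

Lemma amul_continuousl (K : numFieldType) (A : banachAlgType K) (b : A) :
  continuous (fun a : A => a ⋆ b).
Proof.
have mulC : continuous (fun p : A * A => p.1 ⋆ p.2).
  apply: (bounded_bilinear (@amul_linearl K A) (@amul_linearr K A) ler01) => x y.
  by rewrite mul1r; exact: ler_norm_amul.
move=> a; apply: (@continuous_comp _ _ _ (fun x : A => (x, b))
  (fun p => p.1 ⋆ p.2)); last exact: mulC.
by apply: cvg_pair; [exact: cvg_id | exact: cvg_cst].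
Qed.

Section point_derivations.
Variables (R : realType) (A : banachAlgType R[i]).
Implicit Types (phi d : A -> R[i]^o).

(* [phi a = (d (a ⋆ b) - d a * phi b) / d b] *)
Lemma point_derivation_continuous phi d b :
  point_derivation phi d -> d b != 0 -> continuous phi.
Proof.
move=> [_ dC dM] db0.
have -> : phi = (fun a => (d b)^-1 *: (d (a ⋆ b) - phi b *: d a)).
  apply/funext => a; rewrite dM /GRing.scale/= [phi b * _]mulrC addrK.
  by rewrite [RHS]mulrC mulfK.
move=> a; apply: cvgZl_tmp; apply: cvgB; last by apply: cvgZl_tmp; exact: dC.
exact: (continuous_comp (@amul_continuousl _ _ b a) (dC _)).
Qed.

(** This is the proof that [Dual] requires to make the restriction of [phi] to [I] an element of the
    dual. *)
Lemma ideal_restrict_dual (I : closedIdeal A) phi :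
  linear phi -> continuous phi ->
  `[< linear (fun x : ideal_elt I => phi x) /\
      continuous (fun x : ideal_elt I => phi x) >].
Proof.
move=> phil phiC; apply/asboolP; split; first by move=> k x y; exact: phil.
(* The norm of [ideal_elt I] is that of [A], so the inclusion is isometric. *)
have valC : continuous (@ideal_val _ _ I).
  move=> x P /nbhs_ballP[e e0 eP].
  apply/(@nbhs_ballP R[i] (ideal_elt I)).
  by exists e; [exact: e0 | move=> y xy; apply: eP; rewrite -!ball_normE in xy *].
by move=> x; exact: (continuous_comp (valC x) (phiC _)).
Qed.

(** The point [x] enters twice, as the algebra element at which the derivation is taken and as the
    argument of the functional; the latter requires [x] to lie in [I]. *)
Lemma ideal_point_derivation0 (I : closedIdeal A) phi d :
  ideal_weakly_amenable I -> linear phi -> continuous phi ->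
  (forall a b, phi (a ⋆ b) = phi a * phi b) -> point_derivation phi d ->
  forall x, ideal_set I x -> phi x != 0 -> d x = 0.
Proof.
move=> wa phil phiC phiM [dl dC dM] x Ix phix0.
pose phiI : dual (ideal_elt I) := Dual (ideal_restrict_dual I phil phiC).
pose D (a : A) : dual_bimod (ideal_bimod I) := d a *: phiI.
have [|f fP] := wa D.
  split.
  - by move=> k a b; rewrite /D dl scalerDl -scalerA.
  - by move=> a; apply: cvgZr_tmp; exact: dC.
  - move=> a b; apply/val_inj/funext => y /=.
    (* The dual actions move onto the argument: [a ·> D b] at [y] is [D b] at [y ⋆ a], and
       [D a <· b] at [y] is [D a] at [b ⋆ y]. *)
    rewrite -[LHS]/(d (a ⋆ b) * phi y).
    rewrite -[RHS]/(d b * phi (y ⋆ a) + d a * phi (b ⋆ y)).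
    by rewrite dM !phiM; ring.
pose xI : ideal_elt I := IdealElt (mem_set Ix).
have /(congr1 (fun g : dual (ideal_elt I) => g xI)) := fP x.
rewrite -[LHS]/(d x * phi x).
rewrite -[RHS]/(f (ideal_ract xI x) - f (ideal_lact x xI)).
(* Both sides have the value [x ⋆ x], so the commutator vanishes here whatever [f] is. *)
have -> : ideal_ract xI x = ideal_lact x xI by exact: val_inj.
by rewrite subrr => /eqP; rewrite mulf_eq0 (negbTE phix0) orbF => /eqP.
Qed.

End point_derivations.

Theorem theorem1p4 (R : realType) (A : banachAlgType R[i]) (I : closedIdeal A)
    (phi : A -> R[i]^o) :
  ideal_weakly_amenable I ->
  character phi ->
  ~ (I `<=` phi @^-1` [set 0]) ->
  ~ exists d : A -> R[i]^o, point_derivation phi d /\ exists a, d a != 0.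
Proof.
move=> wa [phil phiM _] In [d [dd [a da0]]].
(* [character] does not include continuity; the non-zero value of [d] supplies it. *)
have phiC := point_derivation_continuous dd da0.
have [x Ix phix0] : exists2 x, ideal_set I x & phi x != 0.
  apply: contra_notP In => nx y Iy /=.
  by apply: contra_notP nx => /eqP; exists y.
have d0 y : ideal_set I y -> phi y != 0 -> d y = 0.
  exact: (ideal_point_derivation0 wa phil phiC phiM dd).
have [dl _ dM] := dd.
have d0A c : phi c != 0 -> d c = 0.
  move=> phic0; have := d0 _ (ideal_mull c Ix).
  rewrite dM phiM mulf_neq0// (d0 x)// mulr0 add0r => /(_ isT)/eqP.
  by rewrite mulf_eq0 (negbTE phix0) orbF => /eqP.
have [phia0|/d0A da] := eqVneq (phi a) 0; last by rewrite da eqxx in da0.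
(* The scalar 1 gives the sum the shape [k *: u + v] in which linearity of [phi] and [d] is
   stated. *)
have := d0A (1 *: x + a).
rewrite phil dl phia0 addr0 !scale1r (d0 x)// add0r => /(_ phix0) da.
by rewrite da eqxx in da0.
Qed.
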